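(* Let $a>0$ and let $\lambda:E\to[0,\infty)$ be continuous. Suppose there exist constants $y_0\ge0$ and $\lambda_{\min}>0$ such that $\lambda(y,j)\ge\lambda_{\min}$ for all $(y,j)\in E$ with $jy\ge y_0$. Then the Markov transition semigroup $P=(P(t))_{t\ge0}$ of the zig-zag process with speed $a$ and switching rate $\lambda$ (with infinitesimal generator $L$, $L\varphi(y,j)=aj\frac{\partial\varphi}{\partial y}(y,j)+\lambda(y,j)(\varphi(y,-j)-\varphi(y,j))$) is Feller, i.e. for every $\varphi\in C_0(E)$ and $t\ge0$ we have $P(t)\varphi\in C_0(E)$.
   Context: $E=\mathbb{R}\times\{-1,+1\}$ with the product topology; $C_0(E)$ is the space of continuous functions on $E$ vanishing at infinity. For $(y,j)\in E$ let $F(t;y,j)=\exp\left(-\int_0^t\lambda(y+ajs,j)\,ds\right)$, $t\ge0$. The zig-zag process $(Y(t),J(t))$ started from $(y,j)$, with law $\mathbb{P}_{y,j}$, is defined as follows: $T_0=0$, $Y(0)=y$, $J(0)=j$; for $i=1,2,\dots$, $Z_i$ is a random variable with $\mathbb{P}_{y,j}(Z_i>t\mid Z_1,\dots,Z_{i-1})=F(t;Y(T_{i-1}),J(T_{i-1}))$, $T_i=T_{i-1}+Z_i$, $J(t)=J(T_{i-1})$ for $T_{i-1}<t<T_i$, $J(T_i)=-J(T_{i-1})$, and $Y(t)=Y(T_{i-1})+J(T_{i-1})a(t-T_{i-1})$ for $T_{i-1}<t\le T_i$. Under the hypotheses, $T_k\to\infty$ almost surely, so the process is defined for all times. Its semigroup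 is $P(t)\varphi(y,j)=\mathbb{E}_{y,j}[\varphi(Y(t),J(t))]$. *)

(* Defs.v *)
From HB Require Import structures.
From mathcomp Require Import all_boot all_order all_algebra.
From mathcomp Require Import all_classical all_reals all_analysis.

Set Implicit Arguments.
Unset Strict Implicit.
Unset Printing Implicit Defensive.

Import Order.TTheory GRing.Theory Num.Theory.
Import numFieldNormedType.Exports.

Local Open Scope classical_set_scope.
Local Open Scope ring_scope.

Definition vanishes_at_infinity (R : realType) (E : topologicalType)
    (f : E -> R) : Prop :=
  forall eps : R, 0 < eps ->
    exists2 K : set E, compact K & forall x, ~ K x -> `|f x| < eps.

Definition C0 (R : realType) (E : topologicalType) (f : E -> R) : Prop :=
  continuous f /\ vanishes_at_infinity f.

Definition feller (R : realType) (E : topologicalType)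
    (Pt : R -> (E -> R) -> E -> R) : Prop :=
  forall (phi : E -> R) (t : R), C0 phi -> 0 <= t -> C0 (Pt t phi).

(* [f] is a version of the conditional probability of [A] given the
   sigma-algebra [G]. *)
Definition cond_prob_version (R : realType) (d : measure_display)
    (T : measurableType d) (P : probability T R) (G : set_system T)
    (A : set T) (f : T -> R) : Prop :=
  [/\ forall B : set R, measurable B -> G (f @^-1` B),
      P.-integrable setT (EFin \o f)
    & forall B : set T, G B -> P (A `&` B) = (\int[P]_(w in B) (f w)%:E)%E].

(* The sigma-algebra generated by Z 0, ..., Z (n - 1). *)
Definition sigma_past (R : realType) (d : measure_display)
    (T : measurableType d) (Z : nat -> T -> R) (n : nat) : set_system T :=
  <<s \bigcup_(k in `I_n) preimage_set_system setT (Z k) measurable >>.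

(* The state space R x {-1,+1} is encoded as R * bool with the product
   topology (bool is discrete): [true] stands for +1 and [false] for -1, so
   that the velocity flip j |-> -j is boolean negation. *)
Section ZigZag.
Variable R : realType.

Definition vel (j : bool) : R := if j then 1 else -1.

Definition flow (a : R) (e : R * bool) (s : R) : R * bool :=
  (e.1 + a * vel e.2 * s, e.2).

Definition survival (a : R) (lam : R * bool -> R) (t : R) (e : R * bool) : R :=
  expR (- \int[lebesgue_measure]_(s in `[0, t]) lam (flow a e s)).

(* Waiting times are indexed from 0: [z i] is the time between the i-th and
   the (i+1)-st switch. *)
Definition switch_time (z : nat -> R) (n : nat) : R := \sum_(i < n) z i.

Fixpoint switch_state (a : R) (e : R * bool) (z : nat -> R) (n : nat)
    : R * bool :=
  if n is m.+1 then
    let e' := flow a (switch_state a e z m) (z m) in (e'.1, ~~ e'.2)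
  else e.

(* The least n such that t < T_(n+1), i.e. the only n with T_n <= t < T_(n+1)
   when t >= 0 and the waiting times are positive.  The value 0 is taken if
   there is no such n, i.e. if the switching times accumulate before t. *)
Definition num_switches (z : nat -> R) (t : R) : nat :=
  if pselect (exists n, t < switch_time z n.+1) is left h then ex_minn h
  else 0%N.

(* The pair (Y(t), J(t)) for the initial state [e] and waiting times [z]. *)
Definition zigzag_path (a : R) (e : R * bool) (z : nat -> R) (t : R)
    : R * bool :=
  let n := num_switches z t in
  flow a (switch_state a e z n) (t - switch_time z n).

Definition zigzag_waiting_times (a : R) (lam : R * bool -> R) (e : R * bool)
    (d : measure_display) (T : measurableType d) (P : probability T R)
    (Z : nat -> {RV P >-> R}) : Prop :=
  forall (n : nat) (t : R), 0 <= t ->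
    cond_prob_version P (sigma_past Z n) [set w | t < Z n w]
      (fun w => survival a lam t (switch_state a e (fun i => Z i w) n)).

Definition zigzag_semigroup (a : R) (d : R * bool -> measure_display)
    (Omega : forall e, measurableType (d e))
    (P : forall e, probability (Omega e) R)
    (Z : forall e, nat -> {RV (P e) >-> R})
    (t : R) (phi : R * bool -> R) (e : R * bool) : R :=
  fine ('E_(P e)[fun w => phi (zigzag_path a e (fun i => Z e i w) t)])%E.

End ZigZag.

(* Main.v *)
Require Import Defs.
From HB Require Import structures.
From mathcomp Require Import all_boot all_order all_algebra.
From mathcomp Require Import all_classical all_reals all_analysis.
From mathcomp Require Import measurable_realfun ring lra.

Set Implicit Arguments.
Unset Strict Implicit.
Unset Printing Implicit Defensive.

Import Order.TTheory GRing.Theory Num.Theory.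
Import numFieldNormedType.Exports.

Local Open Scope classical_set_scope.
Local Open Scope ring_scope.

(** The semigroup is expanded along the number of switches before time [t].

    Given the past, the waiting time in a state [x] has the density
    [lam (flow a x z) * survival z x] on [0, +oo[; it has mass one because a
    trajectory that does not switch ends in the region where the rate is bounded
    below.  For a function [h] of a state and of a remaining time [r], let
<<
      switch_op h (x, r) =
        integral over 0 <= z <= r of
          h (turn (flow a x z), r - z) * (density of the waiting time at z).
>>
    If [X n] and [S n] are the state and the time of the n-th switch, then
    conditioning on the first n waiting times gives
    [E h (X n, t - S n) = iter n switch_op h (e, t)] ([integral_payoff]).
    Taking for [h] the value of [phi] when no further switch occurs, the
    expectation of [phi] at time [t] equals the sum over k < n of the k-th iterates,
    up to a constant times the probability that [S n <= t]
    ([expectation_dyson]).  The switch is undone from the last one backwards, so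
    the processes issued from distinct points, which live on unrelated probability
    spaces, never have to be compared.

    Continuity.  Each iterate is continuous in the state for a fixed remaining
    time, by dominated convergence ([payoff_switch_op]).  Up to time [t] a path
    moves by at most [a * t], and there the continuous rate is bounded by some [M].
    In the norm weighted by [expR (2 * M * r)] the operator [switch_op] contracts by
    1/2 ([switch_op_halves]), so the probability of n switches before [t] is at most
    [expR (2 * M * t) / 2 ^ n], uniformly for starting points in a compact set
    ([iter_switch_op_le]).  This shows at once that switching times do not accumulate
    and that the expansion converges locally uniformly; its sum is therefore
    continuous.

    Vanishing at infinity follows from the finite speed: a path issued from a
    remote point cannot reach, by time [t], a compact set outside which [phi] is
    small. *)

(** * Measures with a density *)

Section density.
Context d (T : measurableType d) (R : realType).
Variables (mu : {measure set T -> \bar R}) (p : T -> R).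
Local Open Scope ereal_scope.

(** The proofs that the density is measurable and nonnegative are arguments so
    that the measure structure can be attached to this constant once and for
    all. *)
Definition density_measure of measurable_fun setT p & (forall x, 0 <= p x)%R :=
  fun A : set T => \int[mu]_(x in A) (p x)%:E.

Variables (mp : measurable_fun setT p) (p_ge0 : forall x, (0 <= p x)%R).
Local Notation nu := (density_measure mp p_ge0).

Let nu0 : nu set0 = 0.
Proof. by rewrite /density_measure integral_set0. Qed.

Let nu_ge0 A : 0 <= nu A.
Proof. by apply: integral_ge0 => x _; rewrite lee_fin. Qed.

Let nu_sigma_additive : semi_sigma_additive nu.
Proof.
move=> F mF tF mUF; rewrite /density_measure; apply: cvg_toP.
  apply: ereal_nondecreasing_is_cvgn => m n mn.
  by apply: lee_sum_nneg_natr => // k _ _; exact: nu_ge0.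
rewrite ge0_integral_bigcup//=.
- by apply/measurable_EFinP; exact: measurable_funTS.
- by move=> x _; rewrite lee_fin.
Qed.

HB.instance Definition _ := isMeasure.Build _ _ _ nu
  nu0 nu_ge0 nu_sigma_additive.

Import HBNNSimple.

(** Both sides are linear and continuous along increasing sequences, so the
    identity passes from indicators, where it is the definition, to simple
    functions and then to their increasing limits. *)
Lemma integral_density_measure (f : T -> \bar R) :
  measurable_fun setT f -> (forall x, 0 <= f x) ->
  \int[nu]_x f x = \int[mu]_x (f x * (p x)%:E).
Proof.
move=> mf f0; pose g := nnsfun_approx measurableT mf.
have mpE : measurable_fun setT (EFin \o p) by exact/measurable_EFinP.
transitivity (limn (fun n => \int[nu]_x (g n x)%:E)).
  rewrite -monotone_convergence//.
  - by apply: eq_integral => x _; apply/esym/cvg_lim => //; exact: cvg_nnsfun_approx.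
  - by move=> n; exact/measurable_EFinP/measurable_funP.
  - by move=> n x _; rewrite lee_fin.
  - by move=> x _ m n mn; rewrite lee_fin; exact/lefP/nd_nnsfun_approx.
transitivity (limn (fun n => \int[mu]_x ((g n x)%:E * (p x)%:E))); last first.
  rewrite -monotone_convergence//.
  - apply: eq_integral => x _; apply/cvg_lim => //.
    by apply: cvgeZr => //; exact: cvg_nnsfun_approx.
  - move=> n; apply: emeasurable_funM => //.
    by exact/measurable_EFinP/measurable_funP.
  - by move=> n x _; rewrite mule_ge0 ?lee_fin.
  - move=> x _ m n mn; apply: lee_wpmul2r; rewrite lee_fin//.
    exact/lefP/nd_nnsfun_approx.
congr (limn _); apply/funext => n.
under [LHS]eq_integral do rewrite fimfunE -fsumEFin//.
under [RHS]eq_integral do rewrite fimfunE -fsumEFin//.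
rewrite ge0_integral_fsum//; last 2 first.
- by move=> y; exact/measurable_EFinP/measurable_funM.
- by move=> y x _; rewrite nnfun_muleindic_ge0.
transitivity (\sum_(k \in range (g n))
    \int[mu]_x ((k * \1_(g n @^-1` [set k]) x)%:E * (p x)%:E)).
  apply: eq_fsbigr => r; rewrite inE => -[z _ <-].
  rewrite integralZl_indic_nnsfun// integral_indic//= setIT.
  under [RHS]eq_integral do rewrite EFinM -muleA.
  rewrite ge0_integralZl ?lee_fin//; last 2 first.
  - by apply: emeasurable_funM => //; exact/measurable_EFinP.
  - by move=> x _; rewrite mule_ge0 ?lee_fin.
  congr (_ * _); rewrite /density_measure integral_mkcond.
  apply: eq_integral => x _; rewrite patchE indicE.
  by case: ifP; rewrite ?mul1e ?mul0e.
rewrite -ge0_integral_fsum//.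
- apply: eq_integral => x _; rewrite ge0_mule_fsuml//.
  by move=> i; rewrite nnfun_muleindic_ge0.
- move=> y; apply: emeasurable_funM => //.
  by exact/measurable_EFinP/measurable_funM.
- by move=> y x _; rewrite mule_ge0 ?nnfun_muleindic_ge0 ?lee_fin.
Qed.

End density.

(** * Joint law of a variable and a waiting time with conditional density *)

Section joint_law.
Context d dS (T : measurableType d) (S : measurableType dS) (R : realType).
Variables (P : probability T R) (V : T -> S) (Z : T -> R) (q : S * R -> R).
Local Open Scope ereal_scope.
Notation leb := (@lebesgue_measure R).

Hypotheses (mV : measurable_fun setT V) (mZ : measurable_fun setT Z).
Hypotheses (mq : measurable_fun setT q) (q_ge0 : forall x, (0 <= q x)%R).
(* [q (v, .)] is the conditional density of [Z] on [0, +oo[ given [V = v]. *)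
Hypothesis q_mass : forall v, \int[leb]_(z in `[0%R, +oo[) (q (v, z))%:E = 1.
Hypothesis tailZ : forall (B : set S) (t : R), measurable B -> (0 <= t)%R ->
  P (V @^-1` B `&` [set w | t < Z w]%R) =
  \int[P]_(w in V @^-1` B) \int[leb]_(z in `[t, +oo[) (q (V w, z))%:E.

Let Q (x : T * R) : R := q (V x.1, x.2) * \1_(`[0%R, +oo[ : set R) x.2.

Let W (x : T * R) : S * R := (V x.1, x.2).

Let mW : measurable_fun setT W.
Proof.
apply: measurable_fun_pair; last exact: measurable_snd.
exact: measurableT_comp.
Qed.

Let mQ : measurable_fun setT Q.
Proof.
apply: measurable_funM; first exact: (measurableT_comp mq mW).
have mI : measurable_fun setT (\1_(`[0%R, +oo[ : set R) : R -> R).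
  by apply: measurable_indic; exact: measurable_itv.
exact: (measurableT_comp mI measurable_snd).
Qed.

Let Q_ge0 x : (0 <= Q x)%R.
Proof. by rewrite /Q mulr_ge0. Qed.

Let VZ (w : T) : S * R := (V w, Z w).

Let mVZ : measurable_fun setT VZ.
Proof. exact: measurable_fun_pair. Qed.

Let nu1 : {measure set (S * R) -> \bar R}.
Proof. unshelve refine (pushforward P VZ); exact: mVZ. Defined.

Let nu2 : {measure set (S * R) -> \bar R}.
Proof.
unshelve refine (pushforward (density_measure (P \x leb) mQ Q_ge0) W).
exact: mW.
Defined.

Let integral_nu2 g : measurable_fun setT g -> (forall x, 0 <= g x) ->
  \int[nu2]_x g x =
  \int[P]_w \int[leb]_(z in `[0%R, +oo[) (g (V w, z) * (q (V w, z))%:E).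
Proof.
move=> mg g0; rewrite ge0_integral_pushforward// preimage_setT.
rewrite integral_density_measure//=; last exact: measurableT_comp.
pose h (x : T * R) := g (W x) * (Q x)%:E.
have mh : measurable_fun setT h.
  apply: emeasurable_funM; first exact: (measurableT_comp mg mW).
  exact/measurable_EFinP.
have h0 x : 0 <= h x by rewrite mule_ge0// lee_fin.
rewrite -[LHS]/(\int[P \x leb]_x h x).
rewrite (@fubini_tonelli1 _ _ _ _ _ P leb h mh h0).
apply: eq_integral => w _; rewrite /fubini_F /h [RHS]integral_mkcond.
apply: eq_integral => z _; rewrite patchE /W /Q /= indicE.
by case: ifP; rewrite ?mulr1// mulr0 mule0.
Qed.

Let integral_nu1 g : measurable_fun setT g -> (forall x, 0 <= g x) ->
  \int[nu1]_x g x = \int[P]_w g (V w, Z w).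
Proof. by move=> mg g0; rewrite ge0_integral_pushforward// preimage_setT. Qed.

Let nu2_rect B t : measurable B -> (0 <= t)%R ->
  nu2 (B `*` `]t, +oo[) =
  \int[P]_(w in V @^-1` B) \int[leb]_(z in `[t, +oo[) (q (V w, z))%:E.
Proof.
move=> mB t0; have mBt : measurable (B `*` `]t, +oo[).
  by apply: measurableX => //; exact: measurable_itv.
rewrite -[LHS]mul1e -[X in X * _]/(1%:E) -integral_cst// integral_mkcond.
rewrite integral_nu2; last 2 first.
  - by apply/(measurable_restrictT _ mBt).
  - by move=> x; rewrite patchE; case: ifP.
rewrite [RHS]integral_mkcond; apply: eq_integral => w _.
rewrite patchE; case: ifPn => [/set_mem Bw|nBw]; last first.
  apply: integral0_eq => z _; rewrite patchE ifF ?mul0e//.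
  by apply/negbTE; apply: contra nBw; rewrite !inE => -[].
rewrite -[RHS]integral_itv_obnd_cbnd; last first.
  exact/measurable_funTS/measurable_EFinP/measurable_fun_pair2.
rewrite integral_mkcond [RHS]integral_mkcond.
apply: eq_integral => z _; rewrite !patchE.
have [zt|zt] := ltP t z.
  rewrite !mem_set ?mul1e//=; first by rewrite in_itv/= zt.
  - by split => //=; rewrite in_itv/= zt.
  - by rewrite in_itv/= (le_trans t0 (ltW zt)).
rewrite [X in _ = if X then _ else _]memNset/=; last first.
  by rewrite in_itv/= andbT ltNge zt.
rewrite [X in if X then 1 else _]memNset ?mul0e ?if_same//.
by move=> -[_/=]; rewrite in_itv/= andbT ltNge zt.
Qed.

Let nu1_rect B t : measurable B -> (0 <= t)%R ->
  nu1 (B `*` `]t, +oo[) =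
  \int[P]_(w in V @^-1` B) \int[leb]_(z in `[t, +oo[) (q (V w, z))%:E.
Proof.
move=> mB t0; rewrite -tailZ//; congr (P _); apply/seteqP; split => w /=.
  by rewrite /VZ in_itv/= andbT.
by move=> [? ?]; split => //=; rewrite in_itv/= andbT.
Qed.

Let mass_nu1 : nu1 setT = 1.
Proof. by rewrite -[RHS](@probability_setT _ _ _ P). Qed.

Let mass_nu2 : nu2 setT = 1.
Proof.
rewrite -[LHS]mul1e -[X in X * _]/(1%:E) -integral_cst// integral_nu2//.
rewrite -[RHS](@probability_setT _ _ _ P) -[RHS]mul1e -integral_cst//.
apply: eq_integral => w _; rewrite -[RHS](q_mass (V w)).
by apply: eq_integral => z _; rewrite mul1e.
Qed.

Let mrect B t : measurable B -> measurable (B `*` `]t, +oo[ : set (S * R)).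
Proof. by move=> mB; apply: measurableX => //; exact: measurable_itv. Qed.

(* A mass-one measure carried by positive times does not see negative times. *)
Let rect_lt0 (nu : {measure set (S * R) -> \bar R}) B t :
  nu setT = 1 -> nu (setT `*` `]0%R, +oo[) = 1 -> measurable B -> (t < 0)%R ->
  nu (B `*` `]t, +oo[) = nu (B `*` `]0%R, +oo[).
Proof.
move=> nuT nuD mB t0; pose D : set (S * R) := setT `*` `]0%R, +oo[.
rewrite -[_ `*` _]/D in nuD.
have mD : measurable D by exact: mrect.
have nuDC : nu (~` D) = 0.
  have nuTy : nu setT < +oo by rewrite nuT ltry.
  transitivity (nu setT - nu (setT `&` D)).
    by rewrite -setTD; exact: measureD.
  by rewrite setTI nuD nuT subee.
transitivity (nu (B `*` `]t, +oo[ `\` D) + nu (B `*` `]t, +oo[ `&` D)).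
  by apply: measureDI => //; exact: mrect.
rewrite [X in X + _](_ : _ = 0) ?add0e.
  congr (nu _); apply/seteqP; split => -[x z]; rewrite /D /= !in_itv/= !andbT.
    by move=> [[Bx _] [_ ?]].
  by move=> [Bx z0]; rewrite (lt_trans t0).
apply/eqP; rewrite -measure_le0 -nuDC le_measure ?inE//.
- by apply: measurableD => //; exact: mrect.
- exact: measurableC.
Qed.

Let nu12 A : measurable A -> nu1 A = nu2 A.
Proof.
pose G := [set B `*` C | B in @measurable _ S & C in @RGenOInfty.G R].
have nuG B t : measurable B -> nu1 (B `*` `]t, +oo[) = nu2 (B `*` `]t, +oo[).
  move=> mB; have [t0|t0] := leP 0%R t; first by rewrite nu1_rect// nu2_rect.
  have m0 : \int[P]_(w in V @^-1` setT)
      \int[leb]_(z in `[0%R, +oo[) (q (V w, z))%:E = 1.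
    rewrite preimage_setT -[RHS](@probability_setT _ _ _ P) -[RHS]mul1e.
    by rewrite -integral_cst//; apply: eq_integral => w _; rewrite q_mass.
  rewrite !rect_lt0//; first by rewrite nu1_rect// nu2_rect.
  - by rewrite nu2_rect.
  - by rewrite nu1_rect.
apply: (measure_unique G (fun k => setT `*` `](- k%:R)%R, +oo[)).
- apply/seteqP; split; last first.
    apply: smallest_sub; first exact: sigma_algebra_measurable.
    by move=> _ [B mB [_ [t ->] <-]]; exact: mrect.
  pose GT := g_sigma_algebraType G.
  have mfst : measurable_fun setT (fst : GT -> S).
    move=> _ B mB; rewrite setTI.
    have -> : fst @^-1` B = \bigcup_k (B `*` `](- k%:R)%R, +oo[ : set GT).
      apply/seteqP; split => [[x z] Bx|[x z] [k _ []]//].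
      exists (Num.truncn `|z|).+1 => //=; split => //=.
      rewrite in_itv/= andbT ltrNl (le_lt_trans (ler_norm _))//.
      by rewrite normrN truncnS_gt.
    apply: bigcup_measurable => k _; apply: sub_sigma_algebra.
    by exists B => //; exists `](- k%:R)%R, +oo[%classic => //; eexists.
  have msnd : measurable_fun setT (snd : GT -> R).
    apply: (measurability _ (RGenOInfty.measurableE R)) => //.
    move=> _ [_ [t ->] <-]; apply: sub_sigma_algebra.
    exists setT => //; exists `]t, +oo[%classic; first by exists t.
    by apply/seteqP; split => -[].
  (* The identity, seen as a map from the generated sigma-algebra to the
     product one, is measurable because both coordinates are. *)
  move=> B mB; have := measurable_fun_pair mfst msnd measurableT mB.
  rewrite setTI; congr (_ _).
  by apply/seteqP; split => -[].
- move=> _ _ [B1 mB1 [_ [t1 ->] <-]] [B2 mB2 [_ [t2 ->] <-]].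
  exists (B1 `&` B2); first exact: measurableI.
  exists `](Num.max t1 t2), +oo[%classic; first by exists (Num.max t1 t2).
  rewrite -setXI; congr (_ `*` _).
  by apply/seteqP; split => z /=; rewrite !in_itv/= !andbT gt_max => /andP.
- by move=> k; exists setT => //; exists `](- k%:R)%R, +oo[%classic => //; eexists.
- apply/seteqP; split => // -[x z] _; exists (Num.truncn `|z|).+1 => //=.
  split => //=; rewrite in_itv/= andbT ltrNl (le_lt_trans (ler_norm _))//.
  by rewrite normrN truncnS_gt.
- by move=> _ [B mB [_ [t ->] <-]]; exact: nuG.
- move=> k; apply: (@le_lt_trans _ _ (nu1 setT)); last first.
    by rewrite mass_nu1 ltry.
  by apply: le_measure; rewrite ?inE//; exact: mrect.
Qed.

(** The law of [(V, Z)] and the image of [P (x) q dz] under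
    [(w, z) |-> (V w, z)] give the same mass to every [B x ]t, +oo[]: for
    [t >= 0] this is the hypothesis on tails, and for [t < 0] both measures are
    carried by positive times.  These sets form a pi-system generating the
    product sigma-algebra, so the two laws agree, and so do the integrals of any
    nonnegative function. *)
Lemma integral_joint_law (g : S * R -> \bar R) :
  measurable_fun setT g -> (forall x, 0 <= g x) ->
  \int[P]_w g (V w, Z w) =
  \int[P]_w \int[leb]_(z in `[0%R, +oo[) (g (V w, z) * (q (V w, z))%:E).
Proof.
move=> mg g0; rewrite -integral_nu1// -integral_nu2//.
by apply: eq_measure_integral => A mA _; exact: nu12.
Qed.

End joint_law.

(** * Functions on the state space *)

Section state_space.
Context (R : realType).
Local Notation E := (R * bool)%type.

(** The direction is discrete, so a neighbourhood of [(y, j)] need only contain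
    states with direction [j]. *)
Lemma continuous_slices (X : topologicalType) (f : E -> X) :
  continuous f <-> forall j, continuous (fun y => f (y, j)).
Proof.
split=> cf => [j y|[y j] A fA].
  apply: continuous_comp; last exact: cf.
  by apply: (@cvg_pair _ _ _ _ (nbhs y) (nbhs j)); [exact: cvg_id|exact: cvg_cst].
exists ((fun y => f (y, j)) @^-1` A, [set j]).
  by split; [exact: (cf j y)|exact: discrete_set1].
by move=> [y' j'] /= [yy' ->].
Qed.

Lemma measurable_slices d (T : measurableType d) (f : E -> T) :
  (forall j, measurable_fun setT (fun y => f (y, j))) -> measurable_fun setT f.
Proof.
move=> mf; rewrite (_ : f = fun e => if e.2 then f (e.1, true) else f (e.1, false)).
  apply: measurable_fun_ifT; first exact: measurable_snd.
  - by apply: measurableT_comp (mf true) _; exact: measurable_fst.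
  - by apply: measurableT_comp (mf false) _; exact: measurable_fst.
by apply/funext => -[y []].
Qed.

Lemma continuous_measurable_state (f : E -> R) :
  continuous f -> measurable_fun setT f.
Proof.
move=> cf; apply: measurable_slices => j; apply: continuous_measurable_fun.
by move/continuous_slices : cf; exact.
Qed.

Lemma continuous_Rintegral_param (f : R -> R -> R) (r : R) :
  (forall y, measurable_fun setT (f y)) ->
  (forall rho : R, exists M : R, forall y z : R, `|y| <= rho -> 0 <= z <= r ->
     `|f y z| <= M) ->
  (forall z : R, 0 <= z <= r -> continuous (f ^~ z)) ->
  continuous (fun y => \int[lebesgue_measure]_(z in `[0, r]) f y z).
Proof.
move=> mf bf cf y.
have [M fM] := bf (`|y| + 1).
have near_y (y' : R) : y' \in `](y - 1), (y + 1)[ -> `|y'| <= `|y| + 1.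
  rewrite in_itv/= => /andP[y1 y2].
  by rewrite ler_norml; have := ler_norm y; have := ler_norm (- y);
    rewrite normrN; lra.
have int_cst : lebesgue_measure.-integrable `[0, r] (EFin \o cst M).
  by apply: continuous_compact_integrable;
    [exact: segment_compact|apply: continuous_subspaceT; exact: cst_continuous].
apply: (@continuity_under_integral _ _ _ _ _ _ _ (y - 1) (y + 1) _ _ (cst M)) => //.
- move=> y' /= y'I; apply: le_integrable int_cst => //.
    by apply/measurable_EFinP; exact: measurable_funTS (mf y').
  move=> z /=; rewrite in_itv/= => z0r; rewrite lee_fin.
  apply: (le_trans (fM y' z _ z0r)); last exact: ler_norm.
  exact: near_y.
- by apply/aeW => z /=; rewrite in_itv/= => z0r y' _; exact: cf.
- move=> y' y'I; apply/aeW => z /=; rewrite in_itv/= => z0r.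
  by apply: fM => //; exact: near_y.
- by rewrite inE/= in_itv/=; lra.
Qed.

End state_space.

(** * Lifetimes with a given hazard rate *)

Section hazard.
Context (R : realType) (r : R -> R).
Hypotheses (r_cont : continuous r) (r_ge0 : forall s, 0 <= r s).
Local Notation leb := (@lebesgue_measure R).

Lemma continuous_integrable_itv (c d : R) :
  leb.-integrable `[c, d] (EFin \o r).
Proof.
apply: continuous_compact_integrable; first exact: segment_compact.
exact: continuous_subspaceT.
Qed.

Lemma Rintegral_hazardB (b c d : R) : b <= c -> c <= d ->
  \int[leb]_(s in `[b, d]) r s - \int[leb]_(s in `[b, c]) r s =
  \int[leb]_(s in `[c, d]) r s.
Proof.
move=> bc cd; rewrite Rintegral_itvB//.
- rewrite Rintegral_itv_obnd_cbnd//.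
  apply: integrableS (continuous_integrable_itv c d) => //.
  by move=> z /=; rewrite !in_itv/= => /andP[/ltW -> ->].
- exact: continuous_integrable_itv.
Qed.

(* Starting the integral at -1 makes the primitive differentiable at 0, so
   that no one-sided derivative is needed there. *)
Let G (t : R) := \int[leb]_(s in `[-1, t]) r s.

Let derG (x : R) : -1 < x -> derivable G x 1 /\ derive1 G x = r x.
Proof.
move=> x1; apply: (@continuous_FTC1_closed _ r (-1) x (x + 1)) => //.
- by rewrite ltrDl.
- exact: continuous_integrable_itv.
- exact: r_cont.
Qed.

Let F (t : R) := expR (- (G t - G 0)).

Let FE (t : R) : 0 <= t -> F t = expR (- \int[leb]_(s in `[0, t]) r s).
Proof. by move=> t0; rewrite /F Rintegral_hazardB//; lra. Qed.

Let is_derive_F (x : R) : -1 < x -> is_derive x 1 (- F) (r x * F x).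
Proof.
move=> x1; have [dG G'] := derG x1.
have dGx : is_derive x 1 G (r x).
  by apply: DeriveDef => //; rewrite -derive1E.
have -> : r x * F x = - (F x *: (- (r x - 0))).
  by rewrite subr0 scalerN opprK mulrC.
have dH : is_derive x 1 (fun t => - (G t - G 0)) (- (r x - 0)).
  by apply: is_deriveN; apply: is_deriveB.
by apply: is_deriveN; apply: is_derive1_comp.
Qed.

Let contF (x : R) : -1 < x -> {for x, continuous F}.
Proof.
move=> x1; have [dF _] := is_derive_F x1.
have : derivable F x 1 by rewrite -[F]opprK; exact: derivableN.
by move/derivable1_diffP; exact: differentiable_continuous.
Qed.

Hypothesis r_mass : \int[leb]_(s in `[0, t]) r s @[t --> +oo] --> +oo.

(** The integrand is the derivative of minus the survival function, which tends
    to 0 because the cumulated hazard is infinite. *)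
Lemma integral_hazard_tail (t : R) : 0 <= t ->
  (\int[leb]_(z in `[t, +oo[) (r z * expR (- \int[leb]_(s in `[0, z]) r s))%:E
   = (expR (- \int[leb]_(s in `[0, t]) r s))%:E)%E.
Proof.
move=> t0.
transitivity (\int[leb]_(z in `[t, +oo[) (r z * F z)%:E)%E.
  apply: eq_integral => z; rewrite inE/= in_itv/= andbT => tz.
  by rewrite FE// (le_trans t0).
rewrite (@ge0_continuous_FTC2y _ _ (- F) _ 0).
- by rewrite -FE// fctE EFinN sub0e oppeK.
- by move=> x _; rewrite mulr_ge0// expR_ge0.
- apply: continuous_in_subspaceT => x; rewrite inE/= in_itv/= andbT => tx.
  apply: continuousM; first exact: r_cont.
  by apply: contF; lra.
- rewrite -oppr0; apply: cvgN.
  have FI : {near +oo, (expR \o -%R) \o (fun t => \int[leb]_(s in `[0, t]) r s) =1 F}.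
    by near=> u; rewrite FE//; near: u; exact: nbhs_pinfty_ge.
  apply: cvg_trans (near_eq_cvg FI) _.
  by apply: cvg_comp r_mass _; exact: cvgr_expR.
- by move=> x tx; have [] := @is_derive_F x _; [lra|].
- by apply: cvg_at_right_filter; apply: cvgN; apply: contF; lra.
- move=> x; rewrite in_itv/= andbT => tx.
  by rewrite derive1E; have [] := @is_derive_F x _; [lra|].
Unshelve. all: by end_near. Qed.

End hazard.

(** * Waiting times of the zig-zag process *)

(** Writing the moving bound as an indicator turns the integral into a section of
    a measurable function of two variables, to which Tonelli applies. *)
Lemma measurable_Rintegral_itv (R : realType) d (X : measurableType d)
    (g : X * R -> R) (u : X -> R) :
  measurable_fun setT g -> (forall x, 0 <= g x) -> measurable_fun setT u ->
  measurable_fun setT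
    (fun x => \int[lebesgue_measure]_(s in `[0, u x]) g (x, s)).
Proof.
move=> mg g0 mu.
pose h (x : X * R) := (if (0 <= x.2) && (x.2 <= u x.1) then g x else 0)%:E.
have mh : measurable_fun setT h.
  apply/measurable_EFinP; apply: measurable_fun_ifT => //.
  apply: measurable_and; apply: measurable_fun_ler => //.
  exact: (measurableT_comp mu measurable_fst).
have h0 x : (0 <= h x)%E by rewrite /h lee_fin; case: ifP.
have mF := @measurable_fun_fubini_tonelli_F _ _ _ _ _ (@lebesgue_measure R) h mh h0.
rewrite (_ : (fun x => _) = fine \o fubini_F lebesgue_measure h); last first.
  apply/funext => x; rewrite /Rintegral /fubini_F /=; congr fine.
  rewrite integral_mkcond; apply: eq_integral => s _.
  rewrite patchE /h /=; have [/set_mem|] := boolP (s \in _).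
    by rewrite /= in_itv/= => ->.
  by rewrite notin_setE /= in_itv/= => /negP/negbTE ->.
exact: measurableT_comp.
Qed.

Section rates.
Context (R : realType) (a : R) (lam : R * bool -> R).
Hypotheses (ha : 0 < a) (lam_cont : continuous lam).
Hypothesis lam_ge0 : forall e, 0 <= lam e.
Local Notation leb := (@lebesgue_measure R).
Local Notation E := (R * bool)%type.

Lemma norm_vel j : `|vel R j| = 1.
Proof. by case: j; rewrite ?normrN normr1. Qed.

Lemma continuous_rate_time (e : E) : continuous (fun s => lam (flow a e s)).
Proof.
move=> s; have cl := (continuous_slices lam).1 lam_cont e.2.
apply: (@continuous_comp _ _ _ (fun s => e.1 + a * vel R e.2 * s)
  (fun y => lam (y, e.2))); last exact: cl.
apply: continuousD; first exact: cst_continuous.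
by apply: continuousM; [exact: cst_continuous|exact: cvg_id].
Qed.

Lemma continuous_flow (s : R) : continuous (fun e : E => flow a e s).
Proof.
apply/continuous_slices => j y.
have cD : {for y, continuous (fun y' => y' + a * vel R j * s)}.
  by apply: continuousD; [exact: cvg_id|exact: cst_continuous].
by apply: (@cvg_pair _ _ _ _ (nbhs (y + a * vel R j * s)) (nbhs j));
  [exact: cD|exact: (@cvg_cst _ j)].
Qed.

Lemma measurable_flow :
  measurable_fun setT (fun x : E * R => flow a x.1 x.2).
Proof.
have mvel : measurable_fun setT (vel R) by move=> _ B mB.
apply: measurable_fun_pair; last first.
  exact: (measurableT_comp measurable_snd measurable_fst).
apply: measurable_funD.
  exact: (measurableT_comp measurable_fst measurable_fst).
apply: measurable_funM; last exact: measurable_snd.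
apply: measurable_funM => //.
by do 2 apply: measurableT_comp => //.
Qed.

Lemma measurable_rate : measurable_fun setT lam.
Proof. exact: continuous_measurable_state. Qed.

Lemma survival_ge0 t e : 0 <= survival a lam t e.
Proof. exact: expR_ge0. Qed.

Lemma survival_le1 t e : survival a lam t e <= 1.
Proof.
rewrite -expR0 ler_expR oppr_le0; apply: Rintegral_ge0 => s _; exact: lam_ge0.
Qed.

Lemma measurable_survival :
  measurable_fun setT (fun x : E * R => survival a lam x.2 x.1).
Proof.
apply: measurableT_comp => //; apply: measurable_funN.
apply: (@measurable_Rintegral_itv _ _ _
  (fun x : (E * R) * R => lam (flow a x.1.1 x.2)) snd) => //.
have m : measurable_fun setT (fun x : (E * R) * R => (x.1.1, x.2)).
  apply: measurable_fun_pair; last exact: measurable_snd.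
  exact: (measurableT_comp measurable_fst measurable_fst).
exact: (measurableT_comp measurable_rate (measurableT_comp measurable_flow m)).
Qed.

Lemma rate_locally_bounded (rho : R) : exists M : R,
  0 < M /\ forall y j, `|y| <= rho -> lam (y, j) <= M.
Proof.
have bnd j : exists M : R, forall y, `|y| <= rho -> lam (y, j) <= M.
  have [rho0|rho0] := leP (- rho) rho; last first.
    by exists 0 => y yr; have := normr_ge0 y; lra.
  have [|c _ Hc] := @EVT_max _ (fun y => lam (y, j)) _ _ rho0.
    apply: continuous_subspaceT; exact: (continuous_slices lam).1 lam_cont j.
  by exists (lam (c, j)) => y; rewrite ler_norml => yr; apply: Hc; rewrite in_itv.
have [M1 HM1] := bnd true; have [M2 HM2] := bnd false.
exists (1 + `|M1| + `|M2|); split.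
  by have := normr_ge0 M1; have := normr_ge0 M2; lra.
move=> y [] yr; [have := HM1 y yr|have := HM2 y yr];
by have := ler_norm M1; have := ler_norm M2; have := normr_ge0 M1;
  have := normr_ge0 M2; lra.
Qed.

Lemma norm_flow (e : E) (s : R) : 0 <= s -> `|(flow a e s).1| <= `|e.1| + a * s.
Proof.
move=> s0; rewrite (le_trans (ler_normD _ _))// lerD2l !normrM norm_vel mulr1.
by rewrite !ger0_norm// ltW.
Qed.

Lemma continuous_survival t : continuous (survival a lam t).
Proof.
apply/continuous_slices => j y.
apply: (@continuous_comp _ _ _
  (fun y => - \int[leb]_(s in `[0, t]) lam (flow a (y, j) s)) (@expR R));
  last exact: continuous_expR.
apply: continuousN.
apply: (@continuous_Rintegral_param _ (fun y s => lam (flow a (y, j) s)) t) => //.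
- by move=> y'; apply: continuous_measurable_fun; exact: continuous_rate_time.
- move=> rho; have [M [M0 HM]] := rate_locally_bounded (rho + a * t).
  exists M => y' z y'r /andP[z0 zt]; rewrite ger0_norm//.
  apply: HM; rewrite (le_trans (norm_flow _ z0))// lerD//.
  by rewrite ler_pM2l.
- move=> z _ y'.
  apply: (@continuous_comp _ _ _ (fun y => flow a (y, j) z) lam);
    last exact: lam_cont.
  apply: (@continuous_comp _ _ _ (fun y => (y, j)) (fun e => flow a e z)).
    by apply: (@cvg_pair _ _ _ _ (nbhs y') (nbhs j)); [exact: cvg_id|exact: cvg_cst].
  exact: continuous_flow.
Qed.

(** Conditional density of the waiting time spent in state [x.1], as a function
    of the time [x.2]. *)
Definition switch_density (x : E * R) : R :=
  lam (flow a x.1 x.2) * survival a lam x.2 x.1.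

Lemma switch_density_ge0 x : 0 <= switch_density x.
Proof. by rewrite mulr_ge0// survival_ge0. Qed.

Lemma measurable_switch_density : measurable_fun setT switch_density.
Proof.
apply: measurable_funM; last exact: measurable_survival.
exact: (measurableT_comp measurable_rate measurable_flow).
Qed.

Lemma continuous_switch_density z : continuous (fun e => switch_density (e, z)).
Proof.
move=> e; apply: continuousM; last exact: continuous_survival.
by apply: continuous_comp; [exact: continuous_flow|exact: lam_cont].
Qed.

Hypothesis hlam : exists y0 lmin : R, [/\ 0 <= y0, 0 < lmin &
  forall (y : R) (j : bool), y0 <= vel R j * y -> lmin <= lam (y, j)].

(** A trajectory that keeps its direction [j] ends up in the region
    [y0 <= j y], where the rate is at least [lmin].  Hence every waiting time is
    finite. *)
Lemma cumulative_rate_pinfty (e : E) :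
  \int[leb]_(s in `[0, t]) lam (flow a e s) @[t --> +oo] --> +oo.
Proof.
have [y0 [lmin [y00 lmin0 Hl]]] := hlam.
(* [z0] is the time at which the trajectory has entered that region. *)
pose z0 := Num.max 0 ((y0 - vel R e.2 * e.1) / a).
have z00 : 0 <= z0 by rewrite le_max lexx.
have lamz s : z0 <= s -> lmin <= lam (flow a e s).
  move=> z0s; apply: Hl.
  have : (y0 - vel R e.2 * e.1) / a <= s.
    by rewrite (le_trans _ z0s)// le_max lexx orbT.
  rewrite ler_pdivrMr// => Hs.
  have v2 : vel R e.2 * vel R e.2 = 1 by case: (e.2); rewrite /vel; lra.
  rewrite mulrDr.
  have -> : vel R e.2 * (a * vel R e.2 * s) =
    (vel R e.2 * vel R e.2) * (s * a) by ring.
  by rewrite v2 mul1r; lra.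
have cr : continuous (fun s => lam (flow a e s)) by exact: continuous_rate_time.
apply/cvgryPge => A; near=> t.
have z0t : z0 <= t by near: t; by apply: nbhs_pinfty_ge; rewrite num_real.
have At : A <= lmin * (t - z0).
  rewrite -ler_pdivrMl// lerBrDr; near: t; by apply: nbhs_pinfty_ge; rewrite num_real.
apply: (le_trans At).
have := Rintegral_hazardB cr z00 z0t.
have : 0 <= \int[leb]_(s in `[0, z0]) lam (flow a e s).
  by apply: Rintegral_ge0.
have : lmin * (t - z0) <= \int[leb]_(s in `[z0, t]) lam (flow a e s).
  apply: (@le_trans _ _ (\int[leb]_(s in `[z0, t]) lmin)).
    rewrite Rintegral_cst//= lebesgue_measure_itv/= lte_fin.
    by case: ltP => [//|tz]; rewrite (le_anti (introT andP (conj tz z0t))) subrr.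
  apply: le_Rintegral => //.
  - by apply: continuous_integrable_itv; exact: cst_continuous.
  - exact: continuous_integrable_itv.
  - by move=> s /=; rewrite in_itv/= => /andP[+ _]; exact: lamz.
lra.
Unshelve. all: by end_near. Qed.

Lemma integral_switch_density (e : E) (t : R) : 0 <= t ->
  (\int[leb]_(z in `[t, +oo[) (switch_density (e, z))%:E
   = (survival a lam t e)%:E)%E.
Proof.
by move=> t0; apply: integral_hazard_tail => //;
  [exact: continuous_rate_time|exact: cumulative_rate_pinfty].
Qed.

Lemma integral_switch_density1 (e : E) :
  (\int[leb]_(z in `[0%R, +oo[) (switch_density (e, z))%:E = 1)%E.
Proof.
by rewrite integral_switch_density// /survival set_itv1 Rintegral_set1 oppr0 expR0.
Qed.

End rates.

(** * The operator of one switch *)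

Section switch_operator.
Context (R : realType) (a : R) (lam : R * bool -> R).
Hypotheses (ha : 0 < a) (lam_cont : continuous lam).
Hypothesis lam_ge0 : forall e, 0 <= lam e.
Hypothesis hlam : exists y0 lmin : R, [/\ 0 <= y0, 0 < lmin &
  forall (y : R) (j : bool), y0 <= vel R j * y -> lmin <= lam (y, j)].
Local Notation leb := (@lebesgue_measure R).
Local Notation E := (R * bool)%type.
Local Notation dens := (switch_density a lam).

Definition turn (e : E) : E := (e.1, ~~ e.2).

Lemma continuous_turn : continuous turn.
Proof.
apply/continuous_slices => j y.
by apply: (@cvg_pair _ _ _ _ (nbhs y) (nbhs (~~ j)));
  [exact: cvg_id|exact: (@cvg_cst _ (~~ j))].
Qed.

Lemma measurable_turn : measurable_fun setT turn.
Proof.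
apply: measurable_fun_pair; first exact: measurable_fst.
exact: (measurable_neg measurable_snd).
Qed.

(** In a pair [x : E * R], [x.1] is a state of the process and [x.2] is the time
    left before the horizon.  If the first switch occurs after a time [z], the
    process restarts from the turned state with [x.2 - z] time left. *)
Definition switch_integrand (h : E * R -> R) (x : E * R) (z : R) : R :=
  h (turn (flow a x.1 z), x.2 - z) * dens (x.1, z).

Definition switch_op (h : E * R -> R) (x : E * R) : R :=
  \int[leb]_(z in `[0, x.2]) switch_integrand h x z.

(** The class of functions on which [switch_op] is iterated.  Continuity is asked
    in the state for each fixed remaining time only: it is then preserved by
    dominated convergence over the fixed interval [0, r], whereas joint
    continuity would involve a moving interval.  Vanishing
    for negative remaining times encodes that switches after the horizon are
    ignored. *)
Definition payoff (C : R) (h : E * R -> R) : Prop :=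
  [/\ measurable_fun setT h, (forall x, 0 <= h x <= C),
      (forall r, continuous (fun e => h (e, r))) &
      (forall e r, r < 0 -> h (e, r) = 0)].

Section one_switch.
Variables (C : R) (h : E * R -> R).
Hypothesis hC : payoff C h.

Let C_ge0 : 0 <= C.
Proof. by have [_ /(_ ((0, true), 0))/andP[h0 hc] _ _] := hC; exact: le_trans hc. Qed.

Lemma measurable_switch_integrand :
  measurable_fun setT (fun y : (E * R) * R => switch_integrand h y.1 y.2).
Proof.
have [mh _ _ _] := hC.
have m11 : measurable_fun setT (fun y : (E * R) * R => (y.1.1, y.2)).
  apply: measurable_fun_pair; last exact: measurable_snd.
  exact: (measurableT_comp measurable_fst measurable_fst).
have md : measurable_fun setT dens by exact: measurable_switch_density.
apply: measurable_funM; last exact: (measurableT_comp md m11).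
have m2 : measurable_fun setT
    (fun y : (E * R) * R => (turn (flow a y.1.1 y.2), y.1.2 - y.2)).
  apply: measurable_fun_pair.
    exact: (measurableT_comp measurable_turn
             (measurableT_comp (measurable_flow a) m11)).
  apply: measurable_funB; last exact: measurable_snd.
  exact: (measurableT_comp measurable_snd measurable_fst).
exact: (measurableT_comp mh m2).
Qed.

Lemma switch_integrand_ge0 x z : 0 <= switch_integrand h x z.
Proof.
have [_ hc _ _] := hC; rewrite mulr_ge0// ?switch_density_ge0//.
by have /andP[] := hc (turn (flow a x.1 z), x.2 - z).
Qed.

Let measurable_integrand x : measurable_fun setT (switch_integrand h x).
Proof. exact: (measurable_fun_pair2 x measurable_switch_integrand). Qed.

(* [h] is at most [C] and the waiting time has total mass one. *)
Let integral_le x :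
  (\int[leb]_(z in `[0%R, x.2]) (switch_integrand h x z)%:E <= C%:E)%E.
Proof.
have mD : measurable_fun setT (fun z => dens (x.1, z)).
  have md : measurable_fun setT dens by exact: measurable_switch_density.
  exact: (measurable_fun_pair2 x.1 md).
apply: (@le_trans _ _ (\int[leb]_(z in `[0%R, +oo[) (C%:E * (dens (x.1, z))%:E))%E).
  apply: (@le_trans _ _
    (\int[leb]_(z in `[0%R, x.2]) (C%:E * (dens (x.1, z))%:E))%E).
    apply: ge0_le_integral => //.
    - by move=> z _; rewrite lee_fin switch_integrand_ge0.
    - by apply/measurable_EFinP; exact: measurable_funTS (measurable_integrand x).
    - apply: measurable_funeM; apply/measurable_EFinP; exact: measurable_funTS mD.
    - move=> z _; rewrite -EFinM lee_fin ler_wpM2r ?switch_density_ge0//.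
      by have [_ /(_ (turn (flow a x.1 z), x.2 - z)) /andP[]] := hC.
  apply: ge0_subset_integral => //.
  - apply: measurable_funeM; apply/measurable_EFinP; exact: measurable_funTS mD.
  - by move=> z _; rewrite -EFinM lee_fin mulr_ge0// switch_density_ge0.
  - by move=> z /=; rewrite !in_itv/= => /andP[->].
rewrite ge0_integralZl//.
- by rewrite integral_switch_density1// mule1.
- by apply/measurable_EFinP; exact: measurable_funTS mD.
- by move=> z _; rewrite lee_fin switch_density_ge0.
Qed.

Lemma switch_opE x : (switch_op h x)%:E =
  (\int[leb]_(z in `[0%R, x.2]) (switch_integrand h x z)%:E)%E.
Proof.
rewrite /switch_op /Rintegral fineK// ge0_fin_numE.
  by rewrite (le_lt_trans (integral_le x))// ltry.
by apply: integral_ge0 => z _; rewrite lee_fin switch_integrand_ge0.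
Qed.

Lemma payoff_switch_op : payoff C (switch_op h).
Proof.
have [mh hc ch h0] := hC; split.
- apply: (measurable_Rintegral_itv measurable_switch_integrand).
    by move=> y; exact: switch_integrand_ge0.
  exact: measurable_snd.
- move=> x; apply/andP; split.
    by apply: Rintegral_ge0 => z _; exact: switch_integrand_ge0.
  by rewrite -lee_fin switch_opE.
- move=> r; apply/continuous_slices => j.
  apply: (@continuous_Rintegral_param _ (fun y => switch_integrand h ((y, j), r))).
  + by move=> y; exact: measurable_integrand.
  + move=> rho; have [M [M0 HM]] := rate_locally_bounded lam_cont (rho + a * r).
    exists (C * M) => y z yrho /andP[z0 zr].
    rewrite ger0_norm ?switch_integrand_ge0//.
    have /andP[? ?] := hc (turn (flow a (y, j) z), r - z).
    apply: ler_pM => //; first exact: switch_density_ge0.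
    rewrite -[leRHS]mulr1; apply: ler_pM => //; first exact: survival_ge0.
      apply: HM; rewrite (le_trans (norm_flow ha _ z0))// lerD//.
      by rewrite ler_pM2l.
    exact: survival_le1.
  + move=> z _ y.
    apply: (@continuous_comp _ _ _ (fun y => (y, j))
      (fun e => switch_integrand h (e, r) z)).
      by apply: (@cvg_pair _ _ _ _ (nbhs y) (nbhs j));
        [exact: cvg_id|exact: (@cvg_cst _ j)].
    apply: continuousM; last exact: continuous_switch_density.
    apply: (@continuous_comp _ _ _ (fun e => turn (flow a e z))
      (fun e => h (e, r - z))); last exact: ch.
    by apply: continuous_comp; [exact: continuous_flow|exact: continuous_turn].
- move=> e r r0; rewrite /switch_op set_itv_ge ?Rintegral_set0//=.
  by rewrite bnd_simp -ltNge.
Qed.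

(** The weight [expR (2 * M * r)] makes [switch_op] a contraction of ratio 1/2
    where the rate is at most [M], since
    [M * expR (2 * M * (r - z))] integrates over [0 <= z <= r] to at most
    [expR (2 * M * r) / 2].  The constraint [|y| + a r <= rho] is preserved along
    the trajectory because the speed is [a]. *)
Lemma switch_op_halves (rho M D : R) :
  0 < M -> 0 <= D -> (forall y j, `|y| <= rho -> lam (y, j) <= M) ->
  (forall e r, 0 <= r -> `|e.1| + a * r <= rho -> h (e, r) <= D * expR (2 * M * r)) ->
  forall e r, 0 <= r -> `|e.1| + a * r <= rho ->
    switch_op h (e, r) <= D / 2 * expR (2 * M * r).
Proof.
move=> M0 D0 HM hD e r r0 er.
have M2 : 0 < 2 * M by rewrite mulr_gt0.
rewrite -lee_fin switch_opE/=.
(* The bound is compared with [k] times an exponential density of rate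
   [2 * M], whose integral is at most 1. *)
pose k := D / 2 * expR (2 * M * r).
have k0 : 0 <= k by rewrite mulr_ge0// ?divr_ge0// expR_ge0.
have mpdf : measurable_fun `[0, r] (EFin \o exponential_pdf (2 * M)).
  apply/measurable_EFinP; apply: measurable_funTS.
  exact: measurable_exponential_pdf.
apply: (@le_trans _ _ (\int[leb]_(z in `[0%R, r])
    (k%:E * (exponential_pdf (2 * M) z)%:E))%E).
  apply: ge0_le_integral => //.
  - by move=> z _; rewrite lee_fin switch_integrand_ge0.
  - by apply/measurable_EFinP; exact: measurable_funTS (measurable_integrand _).
  - exact: measurable_funeM.
  move=> z /=; rewrite in_itv/= => /andP[z0 zr]; rewrite -EFinM lee_fin.
  rewrite exponential_pdfE//.
  have -> : k * (2 * M * expR (- (2 * M) * z)) = D * expR (2 * M * (r - z)) * M.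
    have -> : 2 * M * (r - z) = 2 * M * r + (- (2 * M) * z) by ring.
    by rewrite expRD /k; field.
  have [_ /(_ (turn (flow a e z), r - z)) /andP[? _] _ _] := hC.
  have nf := norm_flow ha e z0.
  apply: ler_pM => //; first exact: switch_density_ge0.
    by apply: hD => /=; rewrite /= in nf er *; rewrite ?mulrBr; lra.
  rewrite -[leRHS]mulr1; apply: ler_pM => //; first exact: survival_ge0.
    apply: HM; apply: le_trans nf _; apply: le_trans er.
    by rewrite lerD2l ler_pM2l.
  exact: survival_le1.
rewrite ge0_integralZl//; last first.
  by move=> z _; rewrite lee_fin exponential_pdf_ge0// ltW.
rewrite -[leRHS]mule1; apply: lee_wpmul2l; first by rewrite lee_fin.
move: r0; rewrite le_eqVlt => /predU1P[<-|r0].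
  by rewrite set_itv1 integral_set1 lee_fin.
rewrite [leLHS](exponential_prob_itv0c (2 * M) r0) -EFinB lee_fin.
by rewrite gerBl expR_ge0.
Qed.

End one_switch.

Lemma payoff_iter_switch_op C h n : payoff C h -> payoff C (iter n switch_op h).
Proof. by move=> hC; elim: n => //= n; exact: payoff_switch_op. Qed.

(** Contraction at each step: the contribution of paths with many switches before
    the horizon decays geometrically, uniformly on compact sets of starting
    points. *)
Lemma iter_switch_op_le C h (rho M : R) : payoff C h ->
  0 < M -> (forall y j, `|y| <= rho -> lam (y, j) <= M) ->
  forall n e r, 0 <= r -> `|e.1| + a * r <= rho ->
    iter n switch_op h (e, r) <= C / 2 ^+ n * expR (2 * M * r).
Proof.
move=> hC M0 HM; have [_ hc _ _] := hC.
have C0 : 0 <= C by have /andP[h0 hle] := hc ((0, true), 0); exact: le_trans hle.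
elim=> [|n IHn] e r r0 er.
  rewrite expr0 divr1; have /andP[_ hle] := hc (e, r).
  rewrite (le_trans hle)// ler_peMr// -expR0 ler_expR.
  by rewrite !mulr_ge0// ltW.
have -> : C / 2 ^+ n.+1 = C / 2 ^+ n / 2 by rewrite exprSr invfM mulrA.
apply: (switch_op_halves (payoff_iter_switch_op n hC) M0 _ HM) => //.
by rewrite divr_ge0// exprn_ge0.
Qed.

End switch_operator.

(** * The chain of switching states and times *)

Section embedded_chain.
Context (R : realType) (a : R).
Local Notation E := (R * bool)%type.

Lemma switch_timeS (z : nat -> R) n :
  switch_time z n.+1 = switch_time z n + z n.
Proof. exact: big_ord_recr. Qed.

Lemma switch_stateS (e : E) (z : nat -> R) n :
  switch_state a e z n.+1 = turn (flow a (switch_state a e z n) (z n)).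
Proof. by []. Qed.

Lemma measurable_switch_time d (T : measurableType d) (z : nat -> T -> R) n :
  (forall k, (k < n)%N -> measurable_fun setT (z k)) ->
  measurable_fun setT (fun w => switch_time (fun i => z i w) n).
Proof.
move=> mz; apply: measurable_sum => i; exact: mz.
Qed.

Lemma measurable_switch_state d (T : measurableType d) (e : E)
    (z : nat -> T -> R) n :
  (forall k, (k < n)%N -> measurable_fun setT (z k)) ->
  measurable_fun setT (fun w => switch_state a e (fun i => z i w) n).
Proof.
elim: n => [|n IHn] mz; first exact: measurable_cst.
have mX : measurable_fun setT (fun w => switch_state a e (fun i => z i w) n).
  by apply: IHn => k kn; apply: mz; exact: ltnW.
have m := measurable_fun_pair mX (mz n (ltnSn n)).
exact: (measurableT_comp (@measurable_turn R)
         (measurableT_comp (measurable_flow a) m)).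
Qed.

End embedded_chain.

Section markov_step.
Context (R : realType) (a : R) (lam : R * bool -> R).
Hypotheses (ha : 0 < a) (lam_cont : continuous lam).
Hypothesis lam_ge0 : forall e, 0 <= lam e.
Hypothesis hlam : exists y0 lmin : R, [/\ 0 <= y0, 0 < lmin &
  forall (y : R) (j : bool), y0 <= vel R j * y -> lmin <= lam (y, j)].
Local Notation leb := (@lebesgue_measure R).
Local Notation E := (R * bool)%type.
Local Notation dens := (switch_density a lam).
Local Notation K := (switch_op a lam).

Variables (e : E) (d : measure_display) (T : measurableType d).
Variables (P : probability T R) (Z : nat -> {RV P >-> R}).
Hypothesis hZ : zigzag_waiting_times a lam e Z.

Let X n (w : T) : E := switch_state a e (fun i => Z i w) n.
Let S n (w : T) : R := switch_time (fun i => Z i w) n.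

Let mX n : measurable_fun setT (X n).
Proof. by apply: (measurable_switch_state a e (z := fun i => Z i)). Qed.

Let mS n : measurable_fun setT (S n).
Proof. by apply: (measurable_switch_time (z := fun i => Z i)). Qed.

Let mXS n : measurable_fun setT (fun w => (X n w, S n w)).
Proof. exact: measurable_fun_pair. Qed.

(* The state and time of the n-th switch are functions of the first n waiting
   times. *)
Let past_XS n (B : set (E * R)) : measurable B ->
  sigma_past Z n ((fun w => (X n w, S n w)) @^-1` B).
Proof.
move=> mB.
pose GT := g_sigma_algebraType
  (\bigcup_(k in `I_n) preimage_set_system setT (Z k) measurable).
have mZ k : (k < n)%N -> measurable_fun setT (Z k : GT -> R).
  move=> kn _ C mC; apply: sub_sigma_algebra; exists k => //.
  by exists C.
have m1 := measurable_switch_state a e (T := GT) (z := fun i => Z i) mZ.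
have m2 := measurable_switch_time (T := GT) (z := fun i => Z i) mZ.
have := measurable_fun_pair m1 m2 measurableT mB.
by rewrite setTI.
Qed.

Let tailZ n (B : set (E * R)) (t : R) : measurable B -> 0 <= t ->
  (P ((fun w => (X n w, S n w)) @^-1` B `&` [set w | t < Z n w]%R) =
  \int[P]_(w in (fun w => (X n w, S n w)) @^-1` B)
    \int[leb]_(z in `[t, +oo[) (dens (X n w, z))%:E)%E.
Proof.
move=> mB t0; have [_ _ H] := hZ n t0.
rewrite setIC H; last exact: past_XS.
by apply: eq_integral => w _; rewrite integral_switch_density.
Qed.

(** The conditional law of the next waiting time given the past depends on the past
    through the current state only, and has density [switch_density]. *)
Lemma integral_switch_step n (g : (E * R) * R -> \bar R) :
  measurable_fun setT g -> (forall x, 0 <= g x)%E ->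
  (\int[P]_w g ((X n w, S n w), Z n w) =
   \int[P]_w \int[leb]_(z in `[0%R, +oo[)
     (g ((X n w, S n w), z) * (dens (X n w, z))%:E))%E.
Proof.
move=> mg g0.
apply: (@integral_joint_law _ _ _ _ _ P (fun w => (X n w, S n w)) (Z n)
  (fun y => dens (y.1.1, y.2))) => //.
- have m : measurable_fun setT (fun y : (E * R) * R => (y.1.1, y.2)).
    apply: measurable_fun_pair; last exact: measurable_snd.
    exact: (measurableT_comp measurable_fst measurable_fst).
  have md : measurable_fun setT dens by exact: measurable_switch_density.
  exact: (measurableT_comp md m).
- by move=> y; exact: switch_density_ge0.
- by move=> v; exact: integral_switch_density1.
- by move=> B t mB t0; exact: tailZ.
Qed.

(** Integrating out the last waiting time is one application of [switch_op].  The
    recursion removes the last switch, not the first, so that only the single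
    probability space attached to the starting point [e] is involved. *)
Lemma integral_payoffS n (C : R) (h : E * R -> R) (t : R) : payoff C h ->
  (\int[P]_w (h (X n.+1 w, t - S n.+1 w))%:E =
   \int[P]_w (K h (X n w, t - S n w))%:E)%E.
Proof.
move=> hC; have [mh hc _ h0] := hC.
pose g (y : (E * R) * R) : \bar R :=
  (h (turn (flow a y.1.1 y.2), t - (y.1.2 + y.2)))%:E.
transitivity (\int[P]_w g ((X n w, S n w), Z n w))%E.
  by apply: eq_integral => w _; rewrite /g /S switch_timeS.
rewrite integral_switch_step; last 2 first.
- apply/measurable_EFinP; apply: (measurableT_comp mh).
  have m : measurable_fun setT (fun y : (E * R) * R => (y.1.1, y.2)).
    apply: measurable_fun_pair; last exact: measurable_snd.
    exact: (measurableT_comp measurable_fst measurable_fst).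
  apply: measurable_fun_pair.
    exact: (measurableT_comp (@measurable_turn R)
      (measurableT_comp (measurable_flow a) m)).
  apply: measurable_funB => //; apply: measurable_funD; last exact: measurable_snd.
  exact: (measurableT_comp measurable_snd measurable_fst).
- move=> y; rewrite lee_fin.
  by have /andP[] := hc (turn (flow a y.1.1 y.2), t - (y.1.2 + y.2)).
apply: eq_integral => w _; rewrite (switch_opE ha lam_cont lam_ge0 hlam hC)/=.
rewrite integral_mkcond [RHS]integral_mkcond.
apply: eq_integral => z _; rewrite !patchE /g /switch_integrand /=.
rewrite opprD addrA -EFinM.
have [z0|z0] := leP 0 z; last first.
  by rewrite !memNset//= in_itv/= leNgt z0.
rewrite (mem_set (_ : `[0, +oo[%classic z)); last by rewrite /= in_itv/= z0.
have [zt|zt] := leP z (t - S n w).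
  by rewrite mem_set//= in_itv/= z0.
rewrite memNset/=; last by rewrite in_itv/= [z <= _]leNgt zt andbF.
by rewrite h0 ?mul0r// subr_lt0.
Qed.

Lemma integral_payoff n (C : R) (h : E * R -> R) (t : R) : payoff C h ->
  (\int[P]_w (h (X n w, t - S n w))%:E = (iter n K h (e, t))%:E)%E.
Proof.
elim: n h => [|n IHn] h hC.
  rewrite -[RHS]mule1 -(probability_setT P) -integral_cst//.
  by apply: eq_integral => w _; rewrite /S /switch_time big_ord0 subr0.
rewrite (integral_payoffS n t hC) IHn -?iterSr//.
exact: payoff_switch_op.
Qed.

(** Zeroth term of the expansion: the expectation of [phi] at the horizon
    restricted to the event that no switch occurs before. *)
Definition no_switch_payoff (phi : E -> R) (x : E * R) : R :=
  if 0 <= x.2 then phi (flow a x.1 x.2) * survival a lam x.2 x.1 else 0.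

Lemma payoff_no_switch (C : R) (phi : E -> R) : continuous phi ->
  (forall x, 0 <= phi x <= C) -> payoff C (no_switch_payoff phi).
Proof.
move=> cphi hphi; split.
- apply: measurable_fun_ifT => //.
    by apply: measurable_fun_ler => //; exact: measurable_snd.
  apply: measurable_funM; last exact: measurable_survival.
  apply: measurableT_comp (measurable_flow a).
  exact: continuous_measurable_state.
- move=> [x r]; rewrite /no_switch_payoff/=; have /andP[p0 pC] := hphi (flow a x r).
  case: ifP => _; last by apply/andP; split => //; exact: le_trans pC.
  have s0 := survival_ge0 a lam r x.
  have s1 : survival a lam r x <= 1 by exact: survival_le1.
  by apply/andP; split; [exact: mulr_ge0|rewrite -[C]mulr1; exact: ler_pM].
- move=> r; rewrite /no_switch_payoff/=.
  case: (0 <= r); last exact: cst_continuous.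
  move=> x; apply: continuousM; last exact: continuous_survival.
  by apply: continuous_comp; [exact: continuous_flow|exact: cphi].
- by move=> x r r0; rewrite /no_switch_payoff/= leNgt r0.
Qed.

(** On the event that exactly n switches occur before [t], the position at time
    [t] is known from the n-th switch, and the probability that the next waiting
    time exceeds [t - S n] is the survival function. *)
Lemma integral_no_switch n (C : R) (phi : E -> R) (t : R) : continuous phi ->
  (forall x, 0 <= phi x <= C) ->
  (\int[P]_w (if S n w <= t < S n.+1 w
    then phi (flow a (X n w) (t - S n w)) else 0)%:E
   = \int[P]_w (no_switch_payoff phi (X n w, t - S n w))%:E)%E.
Proof.
move=> cphi hphi.
pose g (y : (E * R) * R) : \bar R := (if (y.1.2 <= t) && (t - y.1.2 < y.2)
   then phi (flow a y.1.1 (t - y.1.2)) else 0)%:E.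
transitivity (\int[P]_w g ((X n w, S n w), Z n w))%E.
  apply: eq_integral => w _; rewrite /g /S switch_timeS /=.
  by rewrite ltrBlDl.
have m12 : measurable_fun setT (fun y : (E * R) * R => y.1.2).
  exact: (measurableT_comp measurable_snd measurable_fst).
have m12' : measurable_fun setT (fun y : (E * R) * R => t - y.1.2).
  exact: measurable_funB.
have m11 : measurable_fun setT (fun y : (E * R) * R => y.1.1).
  exact: (measurableT_comp measurable_fst measurable_fst).
rewrite integral_switch_step; last 2 first.
- apply/measurable_EFinP; apply: measurable_fun_ifT => //.
    apply: measurable_and; first exact: measurable_fun_ler.
    by apply: measurable_fun_ltr => //; exact: measurable_snd.
  have mphi := continuous_measurable_state cphi.
  exact: (measurableT_comp mphi
    (measurableT_comp (measurable_flow a) (measurable_fun_pair m11 m12'))).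
- move=> y; rewrite lee_fin; case: ifP => // _.
  by have /andP[] := hphi (flow a y.1.1 (t - y.1.2)).
apply: eq_integral => w _; rewrite /no_switch_payoff /g/= subr_ge0.
case: ifPn => [St|_]/=; last by rewrite integral0_eq// => z _; rewrite mul0e.
set p := phi _; have p0 : 0 <= p by have /andP[] := hphi (flow a (X n w) (t - S n w)).
have md : measurable_fun setT (fun z => dens (X n w, z)).
  have md : measurable_fun setT dens by exact: measurable_switch_density.
  exact: (measurable_fun_pair2 (X n w) md).
rewrite EFinM -(integral_switch_density ha lam_cont lam_ge0 hlam);
  last by rewrite subr_ge0.
rewrite -ge0_integralZl//; last 2 first.
- by apply/measurable_EFinP; exact: measurable_funTS md.
- by move=> z _; rewrite lee_fin switch_density_ge0.
rewrite -[RHS]integral_itv_obnd_cbnd; last first.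
  by apply: measurable_funeM; apply/measurable_EFinP; exact: measurable_funTS md.
rewrite integral_mkcond [RHS]integral_mkcond.
apply: eq_integral => z _; rewrite !patchE.
have [tz|tz] := ltP (t - S n w) z.
  rewrite !mem_set//= in_itv/= andbT//.
  by rewrite (le_trans _ (ltW tz))// subr_ge0.
rewrite [in RHS]memNset/=; last by rewrite in_itv/= andbT ltNge tz.
by rewrite mul0e if_same.
Qed.

End markov_step.

(** * Paths *)

Section path.
Context (R : realType) (a : R).
Local Notation E := (R * bool)%type.
Implicit Types (e : E) (z : nat -> R) (t : R).

(** The second alternative is the default value 0 taken when the switching times
    accumulate before [t]. *)
Lemma num_switchesP z t n : num_switches z t = n <->
  (t < switch_time z n.+1 /\ forall k, (k < n)%N -> switch_time z k.+1 <= t) \/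
  (n = 0%N /\ forall k, switch_time z k.+1 <= t).
Proof.
rewrite /num_switches; case: pselect => [ex|nex]; last first.
  split=> [<-|[[tn _]|[-> //]]]; last by case: nex; exists n.
  right; split=> // k; rewrite leNgt; apply/negP => tk.
  by apply: nex; exists k.
case: ex_minnP => m tm min_m; split=> [<-|].
  left; split=> // k km; rewrite leNgt; apply/negP => /min_m.
  by rewrite leqNgt km.
move=> [[tn min_n]|[_ H]]; last by case: ex => k; rewrite ltNge H.
apply/eqP; rewrite eqn_leq min_m//= leqNgt; apply/negP => /min_n.
by rewrite leNgt tm.
Qed.

Lemma switch_time_le z m n : (forall i, 0 <= z i) -> (m <= n)%N ->
  switch_time z m <= switch_time z n.
Proof.
move=> z0 /subnK <-; elim: (n - m)%N => [|k IHk]; first by rewrite add0n.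
by rewrite addSn switch_timeS (le_trans IHk)// lerDl.
Qed.

Lemma num_switches_eq z t n : (forall i, 0 <= z i) ->
  switch_time z n <= t -> t < switch_time z n.+1 -> num_switches z t = n.
Proof.
move=> z0 nt tn; apply/num_switchesP; left; split=> // k kn.
by apply: le_trans nt; exact: switch_time_le.
Qed.

Lemma dist_flow e t : 0 < a -> 0 <= t -> `|(flow a e t).1 - e.1| <= a * t.
Proof.
move=> a0 t0; rewrite /= addrC addKr !normrM norm_vel mulr1.
by rewrite !ger0_norm// ltW.
Qed.

Lemma dist_switch_state e z n : 0 < a -> (forall i, 0 <= z i) ->
  `|(switch_state a e z n).1 - e.1| <= a * switch_time z n.
Proof.
move=> a0 z0; elim: n => [|n IHn].
  by rewrite /switch_time big_ord0 mulr0 subrr normr0.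
rewrite switch_timeS switch_stateS mulrDr.
have -> : (turn (flow a (switch_state a e z n) (z n))).1 - e.1 =
  ((switch_state a e z n).1 - e.1) +
  ((flow a (switch_state a e z n) (z n)).1 - (switch_state a e z n).1).
  by rewrite /=; ring.
by rewrite (le_trans (ler_normD _ _))// lerD// dist_flow.
Qed.

(** The speed is [a].  The bound holds also for paths whose switching times
    accumulate before [t], which are continued without any switch. *)
Lemma dist_zigzag_path e z t : 0 < a -> (forall i, 0 <= z i) -> 0 <= t ->
  `|(zigzag_path a e z t).1 - e.1| <= a * t.
Proof.
move=> a0 z0 t0; rewrite /zigzag_path; set n := num_switches z t.
have nt : switch_time z n <= t.
  have /num_switchesP[[_ min_n]|[-> _]] : num_switches z t = n by [].
    by case: (n) min_n => [_|m ->//]; rewrite /switch_time big_ord0.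
  by rewrite /switch_time big_ord0.
set x := switch_state a e z n; set s := switch_time z n in nt *.
have -> : (flow a x (t - s)).1 - e.1 =
  (x.1 - e.1) + ((flow a x (t - s)).1 - x.1) by rewrite /=; ring.
have -> : a * t = a * s + a * (t - s) by ring.
rewrite (le_trans (ler_normD _ _))// lerD//; first exact: dist_switch_state.
by rewrite dist_flow// subr_ge0.
Qed.

(** The path at time [t] is measurable on each of the countably many measurable
    events on which the number of switches is fixed. *)
Lemma measurable_zigzag_path d (T : measurableType d) e t (z : nat -> T -> R) :
  (forall k, measurable_fun setT (z k)) ->
  measurable_fun setT (fun w => zigzag_path a e (fun i => z i w) t).
Proof.
move=> mz; pose N n := [set w | num_switches (fun i => z i w) t = n].
have mS n : measurable_fun setT (fun w => switch_time (fun i => z i w) n).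
  exact: measurable_switch_time.
have mle n : measurable [set w | switch_time (fun i => z i w) n <= t].
  rewrite -[X in measurable X]setTI.
  by apply: (measurable_fun_ler (mS n) (measurable_cst t)) (measurableT) [set true] _.
have mlt n : measurable [set w | t < switch_time (fun i => z i w) n].
  rewrite -[X in measurable X]setTI.
  by apply: (measurable_fun_ltr (measurable_cst t) (mS n)) (measurableT) [set true] _.
have mN n : measurable (N n).
  have -> : N n =
    ([set w | t < switch_time (fun i => z i w) n.+1] `&`
     \bigcap_(k in `I_n) [set w | switch_time (fun i => z i w) k.+1 <= t]) `|`
    (if n == 0%N then \bigcap_k [set w | switch_time (fun i => z i w) k.+1 <= t]
     else set0).
    apply/seteqP; split => w.
      rewrite /N/= => /num_switchesP[[tn H]|[-> H]]; first by left; split.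
      by right => k _; exact: H.
    move=> Hw; rewrite /N/=; apply/num_switchesP.
    case: Hw => [[tn H]|]; first by left.
    by case: eqP => // -> H; right; split => // k; exact: H.
  apply: measurableU.
    by apply: measurableI => //; apply: bigcap_measurableType.
  case: (n == 0%N); last exact: measurable0.
  by apply: bigcap_measurableType.
have -> : setT = \bigcup_n N n by apply/seteqP; split => // w _; eexists.
apply/measurable_fun_bigcup => // n.
apply: (@eq_measurable_fun _ _ _ _ _ (fun w =>
  flow a (switch_state a e (fun i => z i w) n)
    (t - switch_time (fun i => z i w) n))).
  by move=> w; rewrite inE /zigzag_path => ->.
apply: measurable_funTS.
have mX : measurable_fun setT (fun w => switch_state a e (fun i => z i w) n).
  exact: measurable_switch_state.
have mtS : measurable_fun setT (fun w => t - switch_time (fun i => z i w) n).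
  exact: measurable_funB.
exact: (measurableT_comp (measurable_flow a) (measurable_fun_pair mX mtS)).
Qed.

End path.

(** * Expansion along the number of switches *)

Section dyson.
Context (R : realType) (a : R) (lam : R * bool -> R).
Hypotheses (ha : 0 < a) (lam_cont : continuous lam).
Hypothesis lam_ge0 : forall e, 0 <= lam e.
Hypothesis hlam : exists y0 lmin : R, [/\ 0 <= y0, 0 < lmin &
  forall (y : R) (j : bool), y0 <= vel R j * y -> lmin <= lam (y, j)].
Local Notation E := (R * bool)%type.
Local Notation K := (switch_op a lam).

(** The n-th iterate under [switch_op] is the probability that at least n
    switches occur before the horizon. *)
Definition time_left (x : E * R) : R := if 0 <= x.2 then 1 else 0.

Lemma payoff_time_left : payoff 1 time_left.
Proof.
split.
- apply: measurable_fun_ifT => //.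
  by apply: measurable_fun_ler => //; exact: measurable_snd.
- by move=> x; rewrite /time_left; case: ifP => _; rewrite lexx ler01.
- by move=> r; rewrite /time_left/=; exact: cst_continuous.
- by move=> e r r0; rewrite /time_left/= leNgt r0.
Qed.

Section expectation.
Variables (e : E) (d : measure_display) (T : measurableType d).
Variables (P : probability T R) (Z : nat -> {RV P >-> R}).
Hypothesis hZ : zigzag_waiting_times a lam e Z.

(** The survival function is 1 at time 0. *)
Lemma waiting_times_ge0 : {ae P, forall w, forall n, 0 <= Z n w}.
Proof.
pose N n := ~` [set w | 0 < Z n w].
have mpos n : measurable [set w | 0 < Z n w].
  have mZ : measurable_fun setT (Z n : T -> R) by [].
  have := mZ measurableT _ (measurable_itv `]0, +oo[); rewrite setTI.
  by congr measurable; apply/seteqP; split => w /=; rewrite in_itv/= andbT.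
have N0 n : P (N n) = 0%E.
  have [_ _ H] := hZ n (lexx 0).
  have past0 : sigma_past Z n setT.
    exact: (@measurableT _ (g_sigma_algebraType
      (\bigcup_(k in `I_n) preimage_set_system setT (Z k) measurable))).
  have := H _ past0; rewrite setIT => H1.
  rewrite probability_setC// H1.
  rewrite [X in (_ - X)%E](_ : _ = 1%E) ?subee//.
  rewrite -[RHS]mul1e -[X in (_ * X)%E](probability_setT P) -integral_cst//.
  apply: eq_integral => w _.
  by rewrite /survival set_itv1 Rintegral_set1 oppr0 expR0.
have : P.-negligible (\bigcup_n N n).
  apply: negligible_bigcup => n; apply/negligibleP; last exact: N0.
  exact: measurableC.
apply: negligibleS => w /= /existsNP[n nw]; exists n => //=.
by apply/negP; rewrite -leNgt; move/negP : nw; rewrite -ltNge => /ltW.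
Qed.

Variables (C : R) (phi : E -> R) (t : R).
Hypotheses (cphi : continuous phi) (phiC : forall x, 0 <= phi x <= C).
Hypothesis t_ge0 : 0 <= t.

Let X n (w : T) : E := switch_state a e (fun i => Z i w) n.
Let S n (w : T) : R := switch_time (fun i => Z i w) n.
Let f (w : T) : R := phi (zigzag_path a e (fun i => Z i w) t).

Let phi_ge0 x : 0 <= phi x.
Proof. by have /andP[] := phiC x. Qed.

Let mS n : measurable_fun setT (S n).
Proof. by apply: (measurable_switch_time (z := fun i => Z i)). Qed.

Let mX n : measurable_fun setT (X n).
Proof. by apply: (measurable_switch_state a e (z := fun i => Z i)). Qed.

Lemma measurable_path_value : measurable_fun setT f.
Proof.
have mp := @measurable_zigzag_path _ a _ _ e t (fun i => Z i : T -> R)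
  (fun k => measurable_funP (Z k)).
exact: (measurableT_comp (continuous_measurable_state cphi) mp).
Qed.

(* The expectation of [now n] is the n-th term of the expansion, and that of
   [late n] the remainder before it. *)
Let late n (w : T) : R := if S n w <= t then f w else 0.
Let now n (w : T) : R :=
  if S n w <= t < S n.+1 w then phi (flow a (X n w) (t - S n w)) else 0.

Let mlate n : measurable_fun setT (late n).
Proof.
apply: measurable_fun_ifT => //; last exact: measurable_path_value.
exact: measurable_fun_ler.
Qed.

Let mnow n : measurable_fun setT (now n).
Proof.
apply: measurable_fun_ifT => //.
  by apply: measurable_and; [exact: measurable_fun_ler|exact: measurable_fun_ltr].
have m := measurable_fun_pair (mX n) (measurable_funB (measurable_cst t) (mS n)).
exact: (measurableT_comp (continuous_measurable_state cphi)
  (measurableT_comp (measurable_flow a) m)).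
Qed.

Let late_ge0 n w : 0 <= late n w.
Proof. by rewrite /late; case: ifP => // _; exact: phi_ge0. Qed.

Let now_ge0 n w : 0 <= now n w.
Proof. by rewrite /now; case: ifP. Qed.

Let lateS n : (\int[P]_w (late n w)%:E =
  (iter n K (no_switch_payoff a lam phi) (e, t))%:E + \int[P]_w (late n.+1 w)%:E)%E.
Proof.
have pft := payoff_no_switch ha lam_cont lam_ge0 cphi phiC.
rewrite -(integral_payoff ha lam_cont lam_ge0 hlam hZ n t pft).
rewrite -(integral_no_switch ha lam_cont lam_ge0 hlam hZ n t cphi phiC).
rewrite -[X in (X + _)%E]/(\int[P]_w (now n w)%:E)%E.
have mnE : measurable_fun setT (EFin \o now n) by exact/measurable_EFinP.
have mlE k : measurable_fun setT (EFin \o late k) by exact/measurable_EFinP.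
transitivity (\int[P]_w ((now n w)%:E + (late n.+1 w)%:E))%E; last first.
  by apply: ge0_integralD; [|move=> w _; rewrite lee_fin|exact: mnE|
    move=> w _; rewrite lee_fin|exact: (mlE n.+1)].
apply: ae_eq_integral; [by []|exact: (mlE n)|
  exact: (emeasurable_funD mnE (mlE n.+1))|].
have := waiting_times_ge0; apply: filterS => w z0 _.
have SS : S n w <= S n.+1 w by rewrite /S switch_timeS lerDl.
rewrite -EFinD; congr EFin; rewrite /late /now.
have [nt|tn] := leP (S n w) t; last first.
  by rewrite /= leNgt (lt_le_trans tn SS) addr0.
have [tn|nt'] := ltP t (S n.+1 w); last by rewrite add0r.
by rewrite addr0 /f /zigzag_path (num_switches_eq (n := n)).
Qed.

(** Splitting by the number of switches before [t].  Accumulating switches cost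
    nothing at this stage: they stay in the remainder for every n. *)
Lemma expectation_split n : (\int[P]_w (f w)%:E =
  (\sum_(k < n) iter k K (no_switch_payoff a lam phi) (e, t))%:E
  + \int[P]_w (late n w)%:E)%E.
Proof.
elim: n => [|n IHn]; last by rewrite IHn lateS addeA -EFinD big_ord_recr.
rewrite big_ord0 add0e; apply: eq_integral => w _.
by rewrite /late /S /switch_time big_ord0 t_ge0.
Qed.

Lemma late_le n :
  (\int[P]_w (late n w)%:E <= (C * iter n K time_left (e, t))%:E)%E.
Proof.
rewrite EFinM -(integral_payoff ha lam_cont lam_ge0 hlam hZ n t payoff_time_left).
have C0 : 0 <= C by have /andP[p0 pC] := phiC e; exact: le_trans pC.
have mh : measurable_fun setT (fun w => time_left (X n w, t - S n w)).
  have [m _ _ _] := payoff_time_left.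
  exact: (measurableT_comp m (measurable_fun_pair (mX n)
    (measurable_funB (measurable_cst t) (mS n)))).
have h0 w : 0 <= time_left (X n w, t - S n w).
  by rewrite /time_left; case: ifP.
rewrite -ge0_integralZl//; last 2 first.
- exact/measurable_EFinP.
- by move=> w _; rewrite lee_fin; exact: h0.
apply: ge0_le_integral => //.
- by move=> w _; rewrite lee_fin.
- exact/measurable_EFinP.
- by apply: measurable_funeM; exact/measurable_EFinP.
move=> w _; rewrite -EFinM lee_fin /late /time_left/= subr_ge0.
case: ifP => _; rewrite ?mulr1 ?mulr0//.
by have /andP[] := phiC (zigzag_path a e (fun i => Z i w) t).
Qed.

(** The truncated Dyson series approximates the expectation up to the probability
    that at least n switches occur before [t]. *)
Lemma expectation_dyson n :
  `|\int[P]_w f w - \sum_(k < n) iter k K (no_switch_payoff a lam phi) (e, t)|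
  <= C * iter n K time_left (e, t).
Proof.
have L0 : (0 <= \int[P]_w (late n w)%:E)%E.
  by apply: integral_ge0 => w _; rewrite lee_fin.
have Lfin : (\int[P]_w (late n w)%:E)%E \is a fin_num.
  by rewrite ge0_fin_numE// (le_lt_trans (late_le n))// ltry.
rewrite /Rintegral (expectation_split n) -(fineK Lfin) -EFinD/=.
rewrite addrC addKr ger0_norm ?fine_ge0//.
by rewrite -lee_fin fineK// late_le.
Qed.

End expectation.
End dyson.

(** * The Feller property *)

Section feller.
Context (R : realType) (a : R) (lam : R * bool -> R).
Hypotheses (ha : 0 < a) (lam_cont : continuous lam).
Hypothesis lam_ge0 : forall e, 0 <= lam e.
Hypothesis hlam : exists y0 lmin : R, [/\ 0 <= y0, 0 < lmin &
  forall (y : R) (j : bool), y0 <= vel R j * y -> lmin <= lam (y, j)].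
Local Notation E := (R * bool)%type.
Local Notation K := (switch_op a lam).

Lemma compact_fst_bounded (A : set E) : compact A ->
  exists rho : R, forall e, A e -> `|e.1| <= rho.
Proof.
move=> cA; have cfst : compact (fst @` A).
  apply: continuous_compact cA; apply: continuous_subspaceT => x.
  exact: cvg_fst.
have /pinfty_ex_gt0[M M0 HM] := compact_bounded cfst.
by exists M => e Ae; apply: HM; exists e.
Qed.

Lemma compact_strip (rho : R) : compact [set e : E | `|e.1| <= rho].
Proof.
rewrite (_ : [set _ | _] = `[- rho, rho] `*` setT).
  by apply: compact_setX; [exact: segment_compact|exact: bool_compact].
by apply/seteqP; split => -[y j] /=; rewrite in_itv/= ler_norml => // -[].
Qed.

Lemma C0_bounded (phi : E -> R) : C0 phi ->
  exists2 C : R, 0 <= C & forall e, `|phi e| <= C.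
Proof.
move=> [cphi vphi]; have [A cA HA] := vphi 1 ltr01.
have cphiA : compact (phi @` A).
  by apply: continuous_compact cA; exact: continuous_subspaceT.
have /pinfty_ex_gt0[M M0 HM] := compact_bounded cphiA.
exists (M + 1) => [|e]; first by rewrite addr_ge0// ltW.
have [Ae|nAe] := pselect (A e).
  by apply: (@le_trans _ _ M); [apply: HM; exists e|rewrite lerDl].
by rewrite (le_trans (ltW (HA _ nAe)))// lerDr ltW.
Qed.

Variables (d : E -> measure_display) (Omega : forall e, measurableType (d e)).
Variables (P : forall e, probability (Omega e) R).
Variables (Z : forall e, nat -> {RV (P e) >-> R}).
Hypothesis hZ : forall e, zigzag_waiting_times a lam e (Z e).
Local Notation Pt := (zigzag_semigroup a Z).

Lemma zigzag_semigroupE t (phi : E -> R) e : Pt t phi e =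
  \int[P e]_w phi (zigzag_path a e (fun i => Z e i w) t).
Proof. by rewrite /zigzag_semigroup unlock. Qed.

Lemma integrable_path_function t (phi : E -> R) (C : R) e : continuous phi ->
  (forall x, `|phi x| <= C) ->
  (P e).-integrable setT
    (EFin \o (fun w => phi (zigzag_path a e (fun i => Z e i w) t))).
Proof.
move=> cphi phiC; apply: (@le_integrable _ _ _ _ _ _ _ (EFin \o cst C)) => //.
- by apply/measurable_EFinP; exact: measurable_path_value.
- by move=> w _; rewrite lee_fin (le_trans (phiC _))// ler_norm.
- exact: finite_measure_integrable_cst.
Qed.

(** Total mass one: it reduces continuity to nonnegative functions. *)
Lemma zigzag_semigroup_shift t (phi : E -> R) (C c : R) e : continuous phi ->
  (forall x, `|phi x| <= C) ->
  Pt t (fun x => phi x + c) e = Pt t phi e + c.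
Proof.
move=> cphi phiC; rewrite !zigzag_semigroupE RintegralD//; last 2 first.
- exact: integrable_path_function phiC.
- exact: finite_measure_integrable_cst.
congr (_ + _); transitivity (c * fine (P e setT)); first exact: Rintegral_cst.
by rewrite probability_setT mulr1.
Qed.

(** Locally uniform limit of the partial sums of the Dyson series, each of which is
    continuous in the starting point. *)
Lemma continuous_zigzag_semigroup_ge0 t (phi : E -> R) (C : R) :
  0 <= t -> continuous phi -> (forall x, 0 <= phi x <= C) -> continuous (Pt t phi).
Proof.
move=> t0 cphi phiC e.
have C0 : 0 <= C by have /andP[p0 pC] := phiC e; exact: le_trans pC.
(* A path issued from the unit neighbourhood of [e] stays within distance
   [rho] of the origin up to time [t]. *)
pose rho := `|e.1| + 1 + a * t.
have [M [M0 HM]] := rate_locally_bounded lam_cont rho.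
pose D n x := \sum_(k < n) iter k K (no_switch_payoff a lam phi) (x, t).
have cD n : continuous (D n).
  elim: n => [|n IHn].
    have -> : D 0%N = cst 0 by apply/funext => x; rewrite /D big_ord0.
    exact: cst_continuous.
  have -> : D n.+1 = fun x => D n x + iter n K (no_switch_payoff a lam phi) (x, t).
    by apply/funext => x; rewrite /D big_ord_recr.
  have pf := payoff_no_switch ha lam_cont lam_ge0 cphi phiC.
  have [_ _ cn _] := payoff_iter_switch_op ha lam_cont lam_ge0 hlam n pf.
  by move=> x; apply: continuousD; [exact: IHn|exact: cn].
have close n x : `|x.1| <= `|e.1| + 1 ->
    `|Pt t phi x - D n x| <= C * (expR (2 * M * t) / 2 ^+ n).
  move=> xe; rewrite zigzag_semigroupE /D.
  have dyson := expectation_dyson ha lam_cont lam_ge0 hlam (hZ x) cphi phiC t0.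
  apply: le_trans (dyson n) _.
  apply: ler_wpM2l => //.
  have := iter_switch_op_le ha lam_cont lam_ge0 hlam (payoff_time_left R) M0 HM n t0.
  move=> /(_ x); rewrite div1r [_^-1 * _]mulrC; apply.
  by rewrite /rho lerD2r.
apply/cvgrPdist_lt => eps eps0.
pose B := C * expR (2 * M * t).
have B0 : 0 <= B by rewrite mulr_ge0// expR_ge0.
(* [m < 2 ^ m] provides the number of terms. *)
have [n Bn] : exists n : nat, B / 2 ^+ n < eps / 3.
  exists (Num.truncn (B / (eps / 3))).+1; set m := _.+1.
  have e3 : 0 < eps / 3 by rewrite divr_gt0.
  rewrite ltr_pdivrMr ?exprn_gt0// mulrC -ltr_pdivrMr//.
  apply: lt_trans (truncnS_gt _) _.
  by rewrite -natrX ltr_nat ltn_expl.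
have /cvgrPdist_lt /(_ (eps / 3)) cDe := cD n e.
have e3 : 0 < eps / 3 by rewrite divr_gt0.
near=> x.
have xe : `|x.1| <= `|e.1| + 1.
  have : `|e.1 - x.1| < 1.
    near: x.
    have /cvgrPdist_lt /(_ 1 ltr01) : (fst x) @[x --> e] --> e.1 by exact: cvg_fst.
    by [].
  have := ler_normB e.1 (e.1 - x.1).
  have -> : e.1 - (e.1 - x.1) = x.1 by ring.
  lra.
have h1 := close n e _; have h2 := close n x xe.
have h3 : `|D n e - D n x| < eps / 3 by near: x; exact: cDe.
rewrite !mulrA -/B in h1 h2.
have -> : Pt t phi e - Pt t phi x =
  (Pt t phi e - D n e) + (D n e - D n x) - (Pt t phi x - D n x) by ring.
rewrite (le_lt_trans (ler_normB _ _))//.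
have := ler_normD (Pt t phi e - D n e) (D n e - D n x).
have : `|Pt t phi e - D n e| <= B / 2 ^+ n by apply: h1; rewrite lerDl.
lra.
Unshelve. all: by end_near. Qed.

(** At infinity, the path cannot reach by time [t] a compact set outside which
    [phi] is small. *)
Lemma zigzag_semigroup_C0 t (phi : E -> R) : C0 phi -> 0 <= t -> C0 (Pt t phi).
Proof.
move=> Cphi t0; have [cphi vphi] := Cphi.
have [C C_ge0 phiC] := C0_bounded Cphi.
split.
  have cs : continuous (Pt t (fun x => phi x + C)).
    apply: (@continuous_zigzag_semigroup_ge0 _ _ (C + C)) => //.
      by move=> x; apply: continuousD; [exact: cphi|exact: cst_continuous].
    move=> x; have := phiC x; rewrite ler_norml => /andP[? ?].
    by apply/andP; split; lra.
  have -> : Pt t phi = (fun e => Pt t (fun x => phi x + C) e - C).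
    by apply/funext => e; rewrite (@zigzag_semigroup_shift _ _ C)// addrK.
  by move=> e; apply: continuousB; [exact: cs|exact: cst_continuous].
move=> eps eps0.
have e2 : 0 < eps / 2 by rewrite divr_gt0.
have [A cA HA] := vphi _ e2; have [rho Hrho] := compact_fst_bounded cA.
exists [set e | `|e.1| <= rho + a * t]; first exact: compact_strip.
move=> e /= /negP; rewrite -ltNge => efar.
rewrite zigzag_semigroupE.
have intf := integrable_path_function t e cphi phiC.
apply: (@le_lt_trans _ _ (eps / 2)); last by lra.
rewrite -lee_fin EFin_normr_Rintegral//.
apply: le_trans (le_abse_integral _ _ (measurable_int _ intf)) _ => //.
apply: (@le_trans _ _ (\int[P e]_w (cst (eps / 2)%:E w))%E); last first.
  rewrite -[leRHS]mule1 -[X in (_ <= _ * X)%E](probability_setT (P e)).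
  by rewrite -integral_cst.
apply: ae_ge0_le_integral => //.
- by apply: measurableT_comp => //; exact: measurable_int intf.
- by move=> w _; rewrite lee_fin ltW.
have := waiting_times_ge0 (hZ e); apply: filterS => w z0 _.
rewrite lee_fin ltW// HA// => /Hrho.
apply/negP; rewrite -ltNge.
have := dist_zigzag_path e ha z0 t0.
set y := (zigzag_path _ _ _ _).1 => dy.
have := ler_normB y (y - e.1).
have -> : y - (y - e.1) = e.1 by ring.
lra.
Qed.

End feller.

Theorem proposition4 (R : realType) (a : R) (lam : R * bool -> R)
    (d : R * bool -> measure_display)
    (Omega : forall e : R * bool, measurableType (d e))
    (P : forall e : R * bool, probability (Omega e) R)
    (Z : forall e : R * bool, nat -> {RV (P e) >-> R})
    (ha : 0 < a)
    (lam_cont : continuous lam)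
    (lam_ge0 : forall e : R * bool, 0 <= lam e)
    (hlam : exists y0 lmin : R, [/\ 0 <= y0, 0 < lmin &
       forall (y : R) (j : bool), y0 <= vel R j * y -> lmin <= lam (y, j)])
    (hZ : forall e : R * bool, zigzag_waiting_times a lam e (Z e)) :
  feller (zigzag_semigroup a Z).
Proof.
by move=> phi t Cphi t0; exact: zigzag_semigroup_C0 Cphi t0.
Qed.
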